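(* Assume that $\mathcal{P}_0$ is an algebraic null hypothesis and let $I_{\mathbb{R}^{k-1}}(\mathcal{P}_0)$ have the reduced Gröbner basis $\mathcal{G}=\{g_{(1)},\dots,g_{(m)}\}$ with respect to a graded monomial order on $\mathbb{R}[\pi_1,\dots,\pi_{k-1}]$. Then: (a) The minimum degree of a non-zero polynomial in $I_{\mathbb{R}^{k-1}}(\mathcal{P}_0)$ is equal to $\min_i\deg(g_{(i)})$. (b) The lowest degree of a sum of squares (SOS) polynomial $\tilde\beta$ corresponding to an NTUB test is $2\min_i\deg(g_{(i)})$. (c) Let $\mathcal{G}_i$ be the set of polynomials in $\mathcal{G}$ of degree less than or equal to $i$, and let $d=\min\{i: V_{\mathbb{R}^{k-1}}(\mathcal{G}_i)\cap\tilde\Delta_{k-1}=\mathcal{P}_0\}$. The lowest degree of an SOS polynomial corresponding to an SUB test is $2d$.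
   Context: Fix $k\ge2$. The simplex $\Delta_{k-1}=\{\boldsymbol\pi\in\mathbb{R}^k:\pi_i\ge0,\sum_i\pi_i=1\}$ is identified with $\tilde\Delta_{k-1}=\{\boldsymbol\pi\in\mathbb{R}^{k-1}:\pi_i\ge0,\ \sum_{i=1}^{k-1}\pi_i\le1\}$ by projection onto the first $k-1$ coordinates ($\pi_k=1-\sum_{i<k}\pi_i$); subsets of $\Delta_{k-1}$ are viewed in $\tilde\Delta_{k-1}$. A null hypothesis $\mathcal{P}_0$ is a subset of the simplex that is nonempty and proper; $\mathcal{P}_A$ is its complement in the simplex. It is algebraic if it is the set of points of the simplex at which finitely many given real polynomials all vanish. For a set $S\subseteq\mathbb{R}^{k-1}$, $I_{\mathbb{R}^{k-1}}(S)\subseteq\mathbb{R}[\pi_1,\dots,\pi_{k-1}]$ is the ideal of polynomials vanishing on $S$; for a set $W$ of polynomials, $V_{\mathbb{R}^{k-1}}(W)\subseteq\mathbb{R}^{k-1}$ is its common real zero set. A monomial order is graded if a monomial of strictly larger total degree is always larger. A polynomial $\tilde\beta\in\mathbb{R}[\pi_1,\dots,\pi_{k-1}]$ is SOS if $\tilde\beta=\sum_{i=1}^l f_{(i)}^2$ for some $f_{(i)}\in\mathbb{R}[\pi_1,\dots,\pi_{k-1}]$. A polynomial $\tilde\beta$ corresponds to an NTUB (non-trivial unbiased) test if it is non-constant on $\tilde\Delta_{k-1}$, $\tilde\beta\le0$ on $\mathcal{P}_0$ and $\tilde\beta\ge0$ on $\mathcal{P}_A$; it corresponds to an SUB (strictly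 unbiased) test if it is non-constant on $\tilde\Delta_{k-1}$, $\tilde\beta\le0$ on $\mathcal{P}_0$ and $\tilde\beta>0$ on $\mathcal{P}_A$. *)

(* Defs.v *)
From mathcomp Require Import all_boot all_order all_algebra.
From mathcomp Require Import boolp classical_sets reals.
From mathcomp Require Import mpoly.

Set Implicit Arguments.
Unset Strict Implicit.
Unset Printing Implicit Defensive.

Import Order.TTheory GRing.Theory Num.Theory.
Local Open Scope classical_set_scope.
Local Open Scope ring_scope.

Definition is_min (D : set nat) (d : nat) : Prop :=
  D d /\ forall e, D e -> (d <= e)%N.

(* [msize p] is the total degree plus one, and [msize 0 = 0], so [deg 0 = 0]. *)
Definition deg (R : realType) (n : nat) (p : {mpoly R[n]}) : nat :=
  (msize p).-1.

Definition vanishing_ideal (R : realType) (n : nat) (S : set 'rV[R]_n) :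
    set {mpoly R[n]} :=
  [set p | forall x, S x -> p.@[x 0] = 0].

Definition zero_set (R : realType) (n : nat) (W : set {mpoly R[n]}) :
    set 'rV[R]_n :=
  [set x | forall p, W p -> p.@[x 0] = 0].

Definition ideal_gen (R : realType) (n : nat) (W : set {mpoly R[n]}) :
    set {mpoly R[n]} :=
  [set p | exists (l : nat) (h f : 'I_l -> {mpoly R[n]}),
      (forall i, W (f i)) /\ p = \sum_(i < l) h i * f i].

Definition is_sos (R : realType) (n : nat) (p : {mpoly R[n]}) : Prop :=
  exists (l : nat) (f : 'I_l -> {mpoly R[n]}), p = \sum_(i < l) f i ^+ 2.

Record monomial_order (n : nat) (le : rel 'X_{1..n}) : Prop := MonomialOrder {
  monomial_order_refl : reflexive le;
  monomial_order_anti : antisymmetric le;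
  monomial_order_trans : transitive le;
  monomial_order_total : total le;
  monomial_order_add : forall m1 m2 m : 'X_{1..n},
    le m1 m2 -> le (m1 + m)%MM (m2 + m)%MM;
  monomial_order_well : forall S : set 'X_{1..n}, S !=set0 ->
    exists2 m, S m & forall m', S m' -> le m m' }.

Definition graded_order (n : nat) (le : rel 'X_{1..n}) : Prop :=
  forall m1 m2 : 'X_{1..n}, (mdeg m1 < mdeg m2)%N -> le m1 m2.

(* The [le]-largest monomial of [p]; the unit monomial [0%MM], which is the
   least one for a monomial order, is only a default value for [p = 0].
   The library's [mlead] is tied to the degrevlex order. *)
Definition lead_mon (R : realType) (n : nat) (le : rel 'X_{1..n})
    (p : {mpoly R[n]}) : 'X_{1..n} :=
  \big[(fun m1 m2 => if le m1 m2 then m2 else m1)/0%MM]_(m <- msupp p) m.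

Definition lead_coeff (R : realType) (n : nat) (le : rel 'X_{1..n})
    (p : {mpoly R[n]}) : R :=
  p@_(lead_mon le p).

Definition lead_term (R : realType) (n : nat) (le : rel 'X_{1..n})
    (p : {mpoly R[n]}) : {mpoly R[n]} :=
  lead_coeff le p *: 'X_[lead_mon le p].

(* The finite set [G] is represented by a list; neither the order nor
   repetitions of its elements matter. *)
Definition groebner_basis (R : realType) (n : nat) (le : rel 'X_{1..n})
    (I : set {mpoly R[n]}) (G : seq {mpoly R[n]}) : Prop :=
  [set` G] `<=` I /\
  ideal_gen (lead_term le @` [set` G]) =
  ideal_gen (lead_term le @` [set p | I p /\ p != 0]).

Definition reduced_groebner_basis (R : realType) (n : nat)
    (le : rel 'X_{1..n}) (I : set {mpoly R[n]}) (G : seq {mpoly R[n]}) : Prop :=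
  [/\ groebner_basis le I G,
      (forall g, g \in G -> lead_coeff le g = 1) &
      (forall g m, g \in G -> m \in msupp g ->
        ~ ideal_gen (lead_term le @` [set h | h \in G /\ h != g]) 'X_[m])].

Definition simplex (R : realType) (k : nat) : set 'rV[R]_k :=
  [set x | (forall i, 0 <= x 0 i) /\ \sum_(i < k) x 0 i = 1].
Arguments simplex : clear implicits.

Definition proj_simplex (R : realType) (k : nat) (x : 'rV[R]_k) :
    'rV[R]_k.-1 :=
  \row_(i < k.-1) x 0 (widen_ord (leq_pred k) i).

Definition simplex_tilde (R : realType) (n : nat) : set 'rV[R]_n :=
  [set x | (forall i, 0 <= x 0 i) /\ \sum_(i < n) x 0 i <= 1].
Arguments simplex_tilde : clear implicits.

Definition null_hypothesis (R : realType) (k : nat) (P0 : set 'rV[R]_k) : Prop :=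
  P0 !=set0 /\ P0 `<` simplex R k.

Definition algebraic_hypothesis (R : realType) (k : nat) (P0 : set 'rV[R]_k) :
    Prop :=
  exists F : seq {mpoly R[k]},
    P0 = simplex R k `&` zero_set [set` F].

Definition alternative (R : realType) (k : nat) (P0 : set 'rV[R]_k) :
    set 'rV[R]_k :=
  simplex R k `\` P0.

Definition nonconstant_on (R : realType) (n : nat) (S : set 'rV[R]_n)
    (p : {mpoly R[n]}) : Prop :=
  exists x y, [/\ S x, S y & p.@[x 0] != p.@[y 0]].

Definition is_NTUB (R : realType) (k : nat) (P0 : set 'rV[R]_k)
    (b : {mpoly R[k.-1]}) : Prop :=
  [/\ nonconstant_on (simplex_tilde R k.-1) b,
      (forall x, (@proj_simplex R k @` P0) x -> b.@[x 0] <= 0) &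
      (forall x, (@proj_simplex R k @` alternative P0) x -> 0 <= b.@[x 0])].

Definition is_SUB (R : realType) (k : nat) (P0 : set 'rV[R]_k)
    (b : {mpoly R[k.-1]}) : Prop :=
  [/\ nonconstant_on (simplex_tilde R k.-1) b,
      (forall x, (@proj_simplex R k @` P0) x -> b.@[x 0] <= 0) &
      (forall x, (@proj_simplex R k @` alternative P0) x -> 0 < b.@[x 0])].

(* Main.v *)
(* A nonzero [p] in the vanishing ideal [I] has a leading monomial divisible by
   that of some [g] in the Groebner basis, and for a graded order this forces
   [deg g <= deg p]; iterating, [p] is reduced to zero using only basis elements
   of degree at most [deg p]. A sum of squares is nonpositive on [P0] exactly when
   all its summands are squares of elements [f i] of [I], and over the reals its
   degree is twice the largest [deg (f i)]. Hence [g ^ 2], for [g] of least degree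
   in the basis, is optimal among NTUB tests, and the sum of [g ^ 2] over the basis
   elements of degree at most [d] is optimal among SUB tests. *)
Require Import Defs.
From mathcomp Require Import all_boot all_order all_algebra.
From mathcomp Require Import boolp classical_sets reals.
From mathcomp Require Import mpoly.
Import Order.TTheory GRing.Theory Num.Theory.
Local Open Scope classical_set_scope.
Local Open Scope ring_scope.

(** * Minima of sets of naturals and leading monomials *)

Lemma is_min_exists (D : set nat) : D !=set0 -> exists d, is_min D d.
Proof.
case=> d Dd; have exD : exists m, `[< D m >] by exists d; apply/asboolP.
case: (ex_minnP exD) => m /asboolP Dm m_min.
by exists m; split=> // e De; apply/m_min/asboolP.
Qed.

(** Totality of [le] makes the fold a maximum, and its default [0%MM] is harmless because it is the
    least monomial. *)
Lemma lead_mon_seqP {n : nat} {le : rel 'X_{1..n}} (hle : monomial_order le)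
    (s : seq 'X_{1..n})
    (M := \big[(fun m1 m2 => if le m1 m2 then m2 else m1)/0%MM]_(m <- s) m) :
  (forall m, m \in s -> le m M) /\ (s != [::] -> M \in s).
Proof.
(* The least monomial [m0] satisfies [m0 + m0 = m0], so it is the unit monomial. *)
have le0 m : le 0%MM m.
  have [m0 _ m0_min] := monomial_order_well hle (ex_intro setT 0%MM I).
  have le_m0D := m0_min (m0 + m0)%MM I.
  have le_Dm0 := monomial_order_add hle m0 (m0_min 0%MM I).
  rewrite add0m in le_Dm0.
  have m0E : (0 + m0 = m0 + m0)%MM.
    by rewrite add0m; apply: (monomial_order_anti hle); rewrite le_m0D.
  by rewrite (addIm m0E) m0_min.
rewrite {}/M; elim: s => [|a s [IHle IHin]]; first by rewrite big_nil.
rewrite big_cons; set M := \big[_/_]_(m <- s) m in IHle IHin *.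
split=> [m|_].
  rewrite inE; case: ifPn => [leaM /orP[/eqP->|/IHle]|nleaM] //.
  have leMa : le M a.
    by have := monomial_order_total hle a M; rewrite (negbTE nleaM).
  case/orP=> [/eqP->|/IHle leM]; first exact: (monomial_order_refl hle).
  exact: (monomial_order_trans hle) leM leMa.
case: ifPn => [leaM|_]; last by rewrite mem_head.
(* For a one-element list, [a] is compared with the default [0%MM]; if the default wins, [a] equals
   it. *)
case: s @M IHle IHin leaM => [|b s] M IHle IHin leaM.
  rewrite /M big_nil in leaM *.
  by rewrite (monomial_order_anti hle (x := a) (y := 0%MM)) ?mem_head // leaM le0.
by rewrite inE IHin ?orbT.
Qed.

Section LeadMon.
Context {R : realType} {n : nat} {le : rel 'X_{1..n}} (hle : monomial_order le).
Implicit Types p q : {mpoly R[n]}.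

Lemma lead_mon_max {p m} : m \in msupp p -> le m (lead_mon le p).
Proof. by move=> mp; apply: (lead_mon_seqP hle _).1. Qed.

Lemma lead_mon_supp {p} : p != 0 -> lead_mon le p \in msupp p.
Proof. by rewrite -msupp_eq0; apply: (lead_mon_seqP hle _).2. Qed.

Lemma lead_coeff_neq0 {p} : p != 0 -> lead_coeff le p != 0.
Proof. by move/lead_mon_supp; rewrite mcoeff_msupp. Qed.

Hypothesis hgr : graded_order le.

(** The monomial [mlead p] attains the degree. A leading monomial of smaller degree would lie below
    it by gradedness and above it by maximality, hence equal it. *)
Lemma mdeg_lead_mon {p} : p != 0 -> mdeg (lead_mon le p) = deg p.
Proof.
move=> p0; apply/eqP; rewrite /deg -(mlead_deg p0) /= eqn_leq; apply/andP; split.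
  by rewrite -ltnS mlead_deg // msize_mdeg_lt // lead_mon_supp.
rewrite leqNgt; apply/negP=> lt_lm.
have le1 := hgr _ _ lt_lm; have le2 := lead_mon_max (mlead_supp p0).
suff E : lead_mon le p = mlead p by rewrite E ltnn in lt_lm.
by apply: (monomial_order_anti hle); rewrite le1.
Qed.

Lemma lead_mon_dvd_deg {p q} : p != 0 -> q != 0 ->
  (lead_mon le p <= lead_mon le q)%MM -> (deg p <= deg q)%N.
Proof.
move=> p0 q0 dvd; rewrite -(mdeg_lead_mon p0) -(mdeg_lead_mon q0).
by rewrite -(submK dvd) mdegD leq_addl.
Qed.

End LeadMon.

(** * Division by a reduced Gröbner basis of a vanishing ideal *)

Section Groebner.
Context {R : realType} {n : nat} {le : rel 'X_{1..n}} (hle : monomial_order le).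
Context {S : set 'rV[R]_n} {G : seq {mpoly R[n]}}.
Hypothesis hG : reduced_groebner_basis le (vanishing_ideal S) G.
Implicit Types p q g : {mpoly R[n]}.

Lemma reduced_groebner_vanish {g x} : g \in G -> S x -> g.@[x 0] = 0.
Proof. by case: hG => -[GI _] _ _ gG; apply: (GI g). Qed.

Lemma reduced_groebner_neq0 {g} : g \in G -> g != 0.
Proof.
case: hG => _ lc1 _ /lc1 lc; apply: contra_eq_neq lc => ->.
by rewrite /lead_coeff mcoeff0 eq_sym oner_eq0.
Qed.

(** The leading term of [p] is a combination of leading terms of [G]. Some summand has a nonzero
    coefficient at [lead_mon le p], and all its monomials are multiples of one [lead_mon le g]. *)
Lemma groebner_lead_dvd {p} : vanishing_ideal S p -> p != 0 ->
  exists2 g, g \in G & (lead_mon le g <= lead_mon le p)%MM.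
Proof.
move=> Ip p0; case: hG => -[_ eqLT] _ _.
have : ideal_gen (lead_term le @` [set` G]) (lead_term le p).
  rewrite eqLT; exists 1%N, (fun=> 1), (fun=> lead_term le p).
  by split=> [_|]; [exists p | rewrite big_ord1 mul1r].
case=> l [h [f [fG eq_lt]]].
have [i nz_i] : exists i, (h i * f i)@_(lead_mon le p) != 0.
  apply/existsP; rewrite -[[exists i, _]]negbK negb_exists.
  apply/negP => /forallP all0.
  have := congr1 (mcoeff (lead_mon le p)) eq_lt.
  rewrite /lead_term mcoeffZ mcoeffX eqxx mulr1 raddf_sum big1 /= => [lc0|j _].
    by have := lead_coeff_neq0 hle p0; rewrite lc0 eqxx.
  by apply/eqP/negPn/all0.
have [g gG gE] := fG i; exists g => //.
move: nz_i; rewrite -gE /lead_term -scalerAr mcoeffZ mulf_eq0 negb_or => /andP[_].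
rewrite -mcoeff_msupp (perm_mem (msuppMX _ _)) => /mapP[m _ ->].
exact: lem_addr.
Qed.

Hypothesis hgr : graded_order le.

Lemma groebner_deg_le {p} : vanishing_ideal S p -> p != 0 ->
  exists2 g, g \in G & (deg g <= deg p)%N.
Proof.
move=> Ip p0; have [g gG dvd_lm] := groebner_lead_dvd Ip p0; exists g => //.
exact: (lead_mon_dvd_deg hle hgr (reduced_groebner_neq0 gG) p0 dvd_lm).
Qed.

(* Division by [G] in a graded order only uses elements of [G] of degree at most
   that of the dividend; it appears here as a minimal counterexample argument. *)
Lemma groebner_zero_deg_le {D : nat} {x : 'rV[R]_n} :
  zero_set [set g | g \in G /\ (deg g <= D)%N] x ->
  forall p, vanishing_ideal S p -> (deg p <= D)%N -> p.@[x 0] = 0.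
Proof.
move=> Gx0; pose bad p := [/\ vanishing_ideal S p, (deg p <= D)%N & p.@[x 0] != 0].
suff nbad p : ~ bad p by move=> p Ip pD; apply/eqP/negP => /negP px; apply: (nbad p).
move=> bad_p.
have [|_ [{bad_p}q [Iq qD qx] <-] mmin] :=
  monomial_order_well hle (S := lead_mon le @` bad); first by exists (lead_mon le p), p.
have q0 : q != 0 by apply: contraNneq qx => ->; rewrite meval0.
have [g gG dvd_lm] := groebner_lead_dvd Iq q0.
have g0 := reduced_groebner_neq0 gG.
have [_ /(_ g gG) lcg _] := hG.
have gD : (deg g <= D)%N := leq_trans (lead_mon_dvd_deg hle hgr g0 q0 dvd_lm) qD.
have gx : g.@[x 0] = 0 by apply: Gx0.
pose u := (lead_mon le q - lead_mon le g)%MM.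
(* Since [g] is monic, [r] loses the leading term of [q]; since [g] vanishes on [S] and at [x], it
   remains a counterexample. *)
pose r := q - lead_coeff le q *: (g * 'X_[u]).
have rx : r.@[x 0] = q.@[x 0] by rewrite mevalB mevalZ mevalM gx mul0r mulr0 subr0.
have r0 : r != 0 by apply: contraNneq qx => r0; rewrite -rx r0 meval0.
have Ir : vanishing_ideal S r.
  move=> y Sy; rewrite mevalB mevalZ mevalM (Iq y Sy) (reduced_groebner_vanish gG Sy).
  by rewrite mul0r mulr0 subr0.
have lm_u : (lead_mon le g + u)%MM = lead_mon le q by rewrite addmC submK.
have supp_le m : m \in msupp r -> le m (lead_mon le q).
  move=> mr; have : m \in msupp q ++ msupp (lead_coeff le q *: (g * 'X_[u])).
    exact: msuppB_le mr.
  rewrite mem_cat => /orP[/(lead_mon_max hle)//|/msuppZ_le].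
  rewrite (perm_mem (msuppMX _ _)) => /mapP[m' m'g ->].
  rewrite -lm_u [(u + _)%MM]addmC.
  exact: (monomial_order_add hle _) (lead_mon_max hle m'g).
have rq0 : r@_(lead_mon le q) = 0.
  rewrite mcoeffB mcoeffZ -{2}lm_u [(lead_mon le g + u)%MM]addmC mcoeffMX.
  by rewrite -!/(lead_coeff le _) lcg mulr1 subrr.
have lm_r := lead_mon_supp hle r0.
have bad_r : bad r.
  split; rewrite ?rx //; apply: leq_trans qD.
  rewrite -(mdeg_lead_mon hle hgr q0) -(mdeg_lead_mon hle hgr r0) leqNgt.
  apply/negP=> lt_d; have ler := supp_le _ lm_r.
  have E : lead_mon le r = lead_mon le q.
    by apply: (monomial_order_anti hle); rewrite ler hgr.
  by rewrite E ltnn in lt_d.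
(* Minimality of [q] makes the leading monomials agree, yet [r] has coefficient zero there. *)
have E : lead_mon le q = lead_mon le r.
  apply: (monomial_order_anti hle); rewrite supp_le // andbT.
  by apply: mmin; exists r.
by move: lm_r; rewrite -E mcoeff_msupp rq0 eqxx.
Qed.

End Groebner.

(** * Values and degrees of sums of squares *)

Section SumOfSquares.
Context {R : realType} {n l : nat} (f : 'I_l -> {mpoly R[n]}).

Lemma meval_sos (x : 'I_n -> R) :
  (\sum_(i < l) f i ^+ 2).@[x] = \sum_(i < l) (f i).@[x] ^+ 2.
Proof. by rewrite raddf_sum /=; apply: eq_bigr => i _; rewrite rmorphXn. Qed.

Lemma sos_le0 (x : 'I_n -> R) :
  (\sum_(i < l) f i ^+ 2).@[x] <= 0 -> forall i, (f i).@[x] = 0.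
Proof.
rewrite meval_sos => le0 i.
have /eqP : \sum_(j < l) (f j).@[x] ^+ 2 = 0.
  by apply/le_anti; rewrite le0 sumr_ge0 // => j _; apply: sqr_ge0.
rewrite psumr_eq0 => [|j _]; last exact: sqr_ge0.
by move/allP/(_ i (mem_index_enum _)); rewrite sqrf_eq0 => /eqP.
Qed.

(* The squares of the coefficients at the largest leading monomial add up to a
   positive number, so top-degree terms cannot cancel. *)
Lemma deg_sos (i : 'I_l) : (2 * deg (f i) <= deg (\sum_(j < l) f j ^+ 2)%R)%N.
Proof.
have [fi0|fi0] := eqVneq (f i) 0; first by rewrite fi0 /deg msize0.
case: (arg_maxP (fun j => mlead (f j)) (erefl : xpredT i)) => j _ j_max.
(* If [f j = 0], its [mlead] is the default [0%MM]; by maximality [f i] is then constant and the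
   bound is trivial. *)
have fj0 : f j != 0 \/ deg (f i) = 0%N.
  have [fj0|] := eqVneq (f j) 0; [right|by left].
  have := lemc_mdeg (j_max i isT).
  by rewrite fj0 mlead0 mdeg0 leqn0 /deg -mlead_deg // => /eqP.
case: fj0 => [fj0|->//].
have le_d : (deg (f i) <= mdeg (mlead (f j)))%N.
  by rewrite /deg -mlead_deg //=; apply/lemc_mdeg/j_max.
have : (\sum_(j < l) f j ^+ 2)@_(mlead (f j) + mlead (f j)) != 0.
  rewrite raddf_sum /=.
  (* As [mlead (f j)] bounds every [mlead (f k)], only one pair of monomials can contribute to this
     coefficient. *)
  have sqr_coef k :
      (f k ^+ 2)@_(mlead (f j) + mlead (f j)) = (f k)@_(mlead (f j)) ^+ 2.
    by rewrite [in LHS]expr2 mleadcMW //; apply: j_max.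
  under eq_bigr do rewrite sqr_coef.
  rewrite psumr_eq0 => [|k _]; last exact: sqr_ge0.
  apply/allPn; exists j; first exact: mem_index_enum.
  by rewrite /= sqrf_eq0 mleadc_eq0.
rewrite -mcoeff_msupp => /msize_mdeg_lt; rewrite mdegD addnn -mul2n => lt_sz.
rewrite -ltnS {2}/deg (ltn_predK lt_sz).
by apply: leq_ltn_trans lt_sz; rewrite leq_mul2l.
Qed.

Lemma deg_sos_le (D : nat) :
  (forall i, deg (f i) <= D)%N -> (deg (\sum_(j < l) f j ^+ 2)%R <= 2 * D)%N.
Proof.
move=> fD; rewrite /deg -ltnS.
suff sz : (msize (\sum_(j < l) f j ^+ 2)%R <= (2 * D).+1)%N.
  by case: (msize _) sz.
apply: (leq_trans (msize_sum _ _ _)); apply/bigmax_leqP => j _.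
have [->|fj0] := eqVneq (f j) 0; first by rewrite expr0n msize0.
have := fD j; rewrite /deg expr2 msizeM // mul2n -addnn.
by rewrite -(mlead_deg fj0) addSn addnS /= ltnS => fjD; apply: leq_add.
Qed.

End SumOfSquares.

(** * Polynomials vanishing on the projected simplex *)

Lemma digit_expansion_inj {n B : nat} (u v : 'I_n -> nat) :
  (forall i, u i < B)%N -> (forall i, v i < B)%N ->
  (\sum_(i < n) u i * B ^ i = \sum_(i < n) v i * B ^ i)%N -> u =1 v.
Proof.
elim: n u v => [|n IHn] u v uB vB; first by move=> _ [].
have B0 : (0 < B)%N by apply: leq_trans (uB ord0).
have shift w : (\sum_(i < n.+1) w i * B ^ i =
    (\sum_(i < n) w (lift ord0 i) * B ^ i) * B + w ord0)%N.
  rewrite big_ord_recl expn0 muln1 addnC big_distrl /=; congr (_ + _)%N.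
  by apply: eq_bigr => i _; rewrite expnSr mulnA.
rewrite !shift => eq_uv.
(* The remainder modulo [B] is the lowest digit; the quotient by [B] carries the others. *)
have eq0 : u ord0 = v ord0.
  by have := congr1 (modn^~ B) eq_uv; rewrite !modnMDl !modn_small.
have eqS : (fun i => u (lift ord0 i)) =1 (fun i => v (lift ord0 i)).
  apply: IHn => //; have := congr1 (divn^~ B) eq_uv.
  by rewrite !divnMDl // !divn_small // !addn0.
by move=> i; case: (unliftP ord0 i) => [j ->|->]; [apply: eqS|].
Qed.

(* Kronecker substitution: along the curve [x_i = t ^ (B ^ i)], with [B] larger
   than every exponent of [p], distinct monomials become distinct powers of [t];
   the curve stays in the simplex for small [t]. *)
Lemma simplex_tilde_dense {R : realType} {n : nat} (p : {mpoly R[n]}) :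
  (forall x, simplex_tilde R n x -> p.@[x 0] = 0) -> p = 0.
Proof.
move=> p0; apply/eqP/negPn/negP => nz_p.
pose B := (msize p).+1; pose w (m : 'X_{1..n}) := (\sum_(i < n) m i * B ^ i)%N.
pose q : {poly R} := \sum_(m <- msupp p) p@_m *: 'X^(w m).
have w_inj : {in msupp p &, injective w}.
  move=> m m' mp m'p; suff lt_exp m1 i : m1 \in msupp p -> (m1 i < B)%N.
    by move/digit_expansion_inj => E; apply/mnmP/E => i; apply: lt_exp.
  move=> /msize_mdeg_lt m1p; apply: (leq_ltn_trans _ (leqW m1p)).
  by rewrite mdegE (bigD1 i) //= leq_addr.
have q_t t : q.[t] = p.@[fun i : 'I_n => t ^+ (B ^ i)].
  rewrite mevalE /q horner_sum; apply: eq_bigr => m _.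
  rewrite hornerZ hornerXn; congr (_ * _); rewrite /w expr_sum.
  by apply: eq_bigr => i _; rewrite -exprM mulnC.
(* By injectivity of [w], the coefficient of [q] at [w (mlead p)] is that of [p] at [mlead p]. *)
have nz_q : q != 0.
  have lm_p := mlead_supp nz_p; move: (lm_p); rewrite mcoeff_msupp.
  apply: contraNneq => q0; have := congr1 (fun r : {poly R} => r`_(w (mlead p))) q0.
  rewrite coef0 coef_sum (bigD1_seq (mlead p)) ?msupp_uniq //=.
  rewrite coefZ coefXn eqxx mulr1 big_seq_cond big1 ?addr0 => [->//|m /andP[mp nm]].
  by rewrite coefZ coefXn (inj_in_eq w_inj) // eq_sym (negbTE nm) mulr0.
(* Each [t] in [ts] is at most [1 / (n + 1)], so the [n] coordinates, all at most [t], sum to at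
   most 1. These are [size q] distinct roots, too many for [q]. *)
pose ts := [seq (n + j).+1%:R^-1 : R | j <- iota 0 (size q)].
suff : (size ts < size q)%N by rewrite size_map size_iota ltnn.
apply: max_poly_roots => //.
  apply/allP => _ /mapP[j _ ->]; rewrite rootE q_t.
  pose x : 'rV[R]_n := \row_i (n + j).+1%:R^-1 ^+ (B ^ i).
  have <- : p.@[x 0] = p.@[fun i : 'I_n => (n + j).+1%:R^-1 ^+ (B ^ i)].
    by apply: meval_eq => i; rewrite mxE.
  rewrite p0 //; split=> [i|].
    by rewrite mxE exprn_ge0 // invr_ge0 ler0n.
  apply: (@le_trans _ _ (\sum_(i < n) (n + j).+1%:R^-1)).
    apply: ler_sum => i _; rewrite mxE -[leRHS]expr1.
    apply: ler_wiXn2l; rewrite ?invr_ge0 ?ler0n ?expn_gt0 //.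
    by rewrite invf_le1 ?ler1n ?ltr0n.
  rewrite sumr_const card_ord -[_ *+ n]mulr_natl ler_pdivrMr ?ltr0n // mul1r ler_nat.
  by rewrite ltnW // ltnS leq_addr.
rewrite map_inj_uniq ?iota_uniq // => i j /invr_inj/eqP.
by rewrite eqr_nat eqSS eqn_add2l => /eqP.
Qed.

(** * The simplex and its projection *)

Section SimplexChart.
Context {R : realType} {n : nat}.

(** Inverts [proj_simplex] on the simplex; [unlift ord_max] singles out the last coordinate. *)
Definition simplex_lift (x : 'rV[R]_n) : 'rV[R]_n.+1 :=
  \row_(i < n.+1)
    if unlift ord_max i is Some j then x 0 j else 1 - \sum_(j < n) x 0 j.

(** The same affine map in polynomial form, for substitution into polynomials in all [n.+1]
    coordinates. *)
Definition simplex_chart : n.+1.-tuple {mpoly R[n]} :=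
  [tuple if unlift ord_max i is Some j then 'X_j else 1 - \sum_(j < n) 'X_j
  | i < n.+1].

Lemma meval_simplex_chart (p : {mpoly R[n.+1]}) (x : 'rV[R]_n) :
  (p \mPo simplex_chart).@[x 0] = p.@[simplex_lift x 0].
Proof.
rewrite comp_mpoly_meval; apply: meval_eq => i; rewrite tnth_mktuple mxE.
case: (unliftP ord_max i) => [j _|_] /=; first exact: mevalXU.
rewrite rmorphB rmorph1; congr (1 - _).
by rewrite [LHS]raddf_sum; apply: eq_bigr => j _; exact: mevalXU.
Qed.

Let widen_lift (i : 'I_n) : widen_ord (leq_pred n.+1) i = lift ord_max i.
Proof. exact/val_inj/esym/lift_max. Qed.

Lemma proj_simplexK {y : 'rV[R]_n.+1} :
  simplex R n.+1 y -> simplex_lift (proj_simplex y) = y.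
Proof.
move=> [_ y1]; apply/rowP => i; rewrite mxE.
case: unliftP => [j ->|->]; first by rewrite mxE widen_lift.
apply/eqP; rewrite subr_eq -y1 big_ord_recr /= addrC; apply/eqP.
congr (_ + _); apply: eq_bigr => j _; rewrite mxE.
by congr (y 0 _); apply: val_inj.
Qed.

Lemma simplex_liftK : cancel simplex_lift (@proj_simplex R n.+1).
Proof. by move=> x; apply/rowP => i; rewrite mxE widen_lift mxE liftK. Qed.

Lemma simplex_lift_in {x} : simplex_tilde R n x -> simplex R n.+1 (simplex_lift x).
Proof.
case=> x0 x1; split=> [i|].
  by rewrite mxE; case: unliftP => [j _|_]; rewrite ?x0 ?subr_ge0.
rewrite big_ord_recr /= mxE unlift_none.
under eq_bigr => i _.
  rewrite (_ : widen_ord _ i = lift ord_max i); last exact/val_inj/esym/lift_max.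
  rewrite mxE liftK; over.
by rewrite addrC subrK.
Qed.

Lemma proj_simplex_in {y} : simplex R n.+1 y -> simplex_tilde R n (proj_simplex y).
Proof.
case=> y0 y1; split=> [i|]; first by rewrite mxE.
rewrite -y1 big_ord_recr /=.
rewrite (eq_bigr (fun i : 'I_n => y 0 (widen_ord (leqnSn n) i))).
  by rewrite lerDl.
by move=> i _; rewrite mxE; congr (y 0 _); apply: val_inj.
Qed.

(** The projection is a bijection between the two simplices, so it commutes with complements. *)
Lemma proj_alternative {P0 : set 'rV[R]_n.+1} : P0 `<=` simplex R n.+1 ->
  @proj_simplex R n.+1 @` alternative P0 =
  simplex_tilde R n `\` @proj_simplex R n.+1 @` P0.
Proof.
move=> sP0; apply/seteqP; split=> [_ [y [Sy nP0y] <-]|x [Sx nPx]].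
  split; first exact: proj_simplex_in.
  case=> z P0z eq_zy; apply: nP0y.
  by rewrite -(proj_simplexK Sy) -eq_zy proj_simplexK //; apply: sP0.
exists (simplex_lift x); last exact: simplex_liftK.
split; first exact: simplex_lift_in.
by move=> P0x; apply: nPx; exists (simplex_lift x) => //; apply: simplex_liftK.
Qed.

(** The equations defining [P0], pulled back along [simplex_chart], belong to the vanishing
    ideal. *)
Lemma algebraic_zero_set {P0 : set 'rV[R]_n.+1} : algebraic_hypothesis P0 ->
  zero_set (vanishing_ideal (@proj_simplex R n.+1 @` P0)) `&` simplex_tilde R n `<=`
  @proj_simplex R n.+1 @` P0.
Proof.
case=> F ->{P0} x [Ix Sx]; exists (simplex_lift x); last exact: simplex_liftK.
split=> [|p Fp]; first exact: simplex_lift_in.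
rewrite -meval_simplex_chart; apply: Ix => _ [y [Sy Fy] <-].
by rewrite meval_simplex_chart proj_simplexK // Fy.
Qed.

End SimplexChart.

Lemma nonconstant_on_neq0 {R : realType} {n : nat} {D : set 'rV[R]_n}
    {b : {mpoly R[n]}} :
  nonconstant_on D b -> b != 0.
Proof. by case=> x [y [_ _]]; apply: contraNneq => ->; rewrite !meval0. Qed.

(** * Lowest degrees of unbiased tests from the Gröbner basis *)

Theorem theorem4 (R : realType) (k : nat) (hk : (2 <= k)%N)
    (P0 : set 'rV[R]_k)
    (hP0 : null_hypothesis P0) (hP0alg : algebraic_hypothesis P0)
    (le : rel 'X_{1..k.-1})
    (hle : monomial_order le) (hgraded : graded_order le)
    (G : seq {mpoly R[k.-1]})
    (hG : reduced_groebner_basis le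
            (vanishing_ideal (@proj_simplex R k @` P0)) G) :
  (exists e : nat,
    [/\ is_min [set deg g | g in [set` G]] e,
        is_min [set deg p | p in
          [set p | vanishing_ideal (@proj_simplex R k @` P0) p /\ p != 0]] e &
        is_min [set deg b | b in
          [set b | is_sos b /\ is_NTUB P0 b]] (2 * e)%N]) /\
  (exists d : nat,
    is_min [set i | zero_set [set g | g \in G /\ (deg g <= i)%N]
                      `&` simplex_tilde R k.-1
                    = @proj_simplex R k @` P0] d /\
    is_min [set deg b | b in
      [set b | is_sos b /\ is_SUB P0 b]] (2 * d)%N).
Proof.
case: k hk P0 hP0 hP0alg le hle hgraded G hG => [//|n] _ P0 hP0 halg le hle hgr G hG.
case: hP0 => -[y0 P0y0] [sP0 nsub].
have altE := proj_alternative sP0.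
have algZ := algebraic_zero_set halg.
set S := _ @` P0 in hG altE algZ *.
rewrite /= in hG altE algZ *.
have sS : S `<=` simplex_tilde R n.
  by move=> _ [y /sP0 /proj_simplex_in ? <-].
pose s0 : 'rV[R]_n := @proj_simplex R n.+1 y0.
have Ss0 : S s0 by exists y0.
(* Properness of [P0] yields a point [a] of the projected alternative. *)
have [a [Sa nPa]] : exists a, simplex_tilde R n a /\ ~ S a.
  have [y nPy] : exists y, ~ (simplex R n.+1 y -> P0 y) by apply/existsNP.
  have /not_implyP[Sy nP0y] := nPy.
  suff [] : (simplex_tilde R n `\` S) (@proj_simplex R n.+1 y).
    by move=> ? ?; exists (@proj_simplex R n.+1 y).
  by rewrite -altE; exists y.
have G0 g : g \in G -> g != 0 := reduced_groebner_neq0 hG.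
have GS g x : g \in G -> S x -> g.@[x 0] = 0 := reduced_groebner_vanish hG.
have sos_vanish l (f : 'I_l -> {mpoly R[n]}) :
    (forall x, S x -> (\sum_(i < l) f i ^+ 2).@[x 0] <= 0) ->
    forall i, vanishing_ideal S (f i).
  by move=> fS i x /fS/sos_le0 ->.
split.
(* Were the ideal zero, [a] would be a common zero and algebraicity would put it in [S]. *)
- have [p [Ip p0]] : exists p, vanishing_ideal S p /\ p != 0.
    have /existsNP[p /not_implyP[Ip /eqP pa]] :
        ~ forall p, vanishing_ideal S p -> p.@[a 0] = 0 by move=> Ia; apply/nPa/algZ.
    by exists p; split=> //; apply: contraNneq pa => ->; rewrite meval0.
  have [e [[g gG ge] e_min]] : exists e, is_min [set deg g | g in [set` G]] e.
    apply: is_min_exists; have [g gG _] := groebner_deg_le hle hG hgr Ip p0.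
    by exists (deg g), g.
  have eI q : vanishing_ideal S q -> q != 0 -> (e <= deg q)%N.
    move=> Iq q0; have [h hG' hq] := groebner_deg_le hle hG hgr Iq q0.
    by apply: leq_trans hq; apply: e_min; exists h.
  have sos_ge b : is_sos b -> is_NTUB P0 b -> (2 * e <= deg b)%N.
    case=> l [f ->] [/nonconstant_on_neq0 nz_b bS _].
    have [i fi0] : exists i, f i != 0.
      apply/existsP; rewrite -[[exists i, _]]negbK negb_exists.
      apply: contra nz_b => /forallP f0; rewrite big1 // => i _.
      by have := f0 i; rewrite negbK => /eqP->; rewrite expr0n.
    apply: leq_trans (deg_sos f i); rewrite leq_mul2l eI //.
    exact: sos_vanish.
  exists e; split; first by split=> //; exists g.
    split; first by exists g => //; split; [move=> x; apply: GS | exact: G0].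
    by move=> _ [q [Iq q0] <-]; apply: eI.
  (* The square is written as a one-term sum so that [deg_sos_le] applies. *)
  pose b : {mpoly R[n]} := \sum_(i < 1) g ^+ 2.
  have bsos : is_sos b by exists 1%N, (fun=> g).
  have bE x : b.@[x] = g.@[x] ^+ 2 by rewrite /b big_ord1 rmorphXn.
  have bntub : is_NTUB P0 b.
    split=> [|x Sx|x _]; last by rewrite bE sqr_ge0.
      (* A nonzero [g] cannot vanish on the whole simplex, whereas [b] vanishes at [s0]. *)
      have /existsNP[x /not_implyP[Sx /eqP gx]] :
          ~ forall x, simplex_tilde R n x -> g.@[x 0] = 0.
        by move/simplex_tilde_dense/eqP; rewrite (negbTE (G0 g gG)).
      exists x, s0; split=> //; first exact: sS.
      by rewrite !bE (GS g s0) // expr0n sqrf_eq0.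
    by rewrite bE (GS g x) // expr0n.
  split; last by move=> _ [c [csos cntub] <-]; apply: sos_ge.
  exists b => //; apply/eqP; rewrite eqn_leq sos_ge // andbT.
  by apply: deg_sos_le => _; rewrite ge.
- have zeroG i : S `<=`
      zero_set [set g | g \in G /\ (deg g <= i)%N] `&` simplex_tilde R n.
    by move=> x Sx; split; [move=> g [gG _]; apply: GS | apply: sS].
  have [d [dZ d_min]] : exists d, is_min [set i |
      zero_set [set g | g \in G /\ (deg g <= i)%N] `&` simplex_tilde R n = S] d.
    apply: is_min_exists; exists (\max_(g <- G) deg g)%N.
    apply/seteqP; split=> [x [Gx Sx]|]; last exact: zeroG.
    apply: algZ; split=> // p Ip.
    (* Raising the bound to cover [deg p] adds no basis elements, as all of [G] is already
       included. *)
    pose D := maxn (deg p) (\max_(g <- G) deg g).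
    apply: (groebner_zero_deg_le hle hG hgr (D := D)) => //.
      by move=> g [gG _]; apply: Gx; split=> //; apply: leq_bigmax_seq.
    exact: leq_maxl.
  have sos_ge b : is_sos b -> is_SUB P0 b -> (2 * d <= deg b)%N.
    case=> l [f ->] [_ bS]; rewrite altE => bA.
    have If := sos_vanish l f bS.
    set q := \sum_(i < l) _ in bA *.
    suff dle : (d <= (deg q)./2)%N.
      by rewrite mul2n -geq_half_double.
    apply: d_min; apply/seteqP; split=> [x [Gx Sx]|]; last exact: zeroG.
    apply: contrapT => nSx; have := bA x (conj Sx nSx).
    rewrite meval_sos big1 ?ltxx // => i _.
    rewrite (groebner_zero_deg_le hle hG hgr Gx _ (If i)) ?expr0n //.
    by rewrite geq_half_double -mul2n deg_sos.
  exists d; split=> //.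
  pose s := [seq g <- G | (deg g <= d)%N].
  pose f (i : 'I_(size s)) := s`_i.
  have fG i : f i \in G /\ (deg (f i) <= d)%N.
    by have := mem_nth 0 (ltn_ord i); rewrite mem_filter => /andP[].
  pose b := \sum_(i < size s) f i ^+ 2.
  have bsos : is_sos b by exists (size s), f.
  have bS x : S x -> b.@[x 0] = 0.
    move=> Sx; rewrite meval_sos big1 // => i _.
    by rewrite (GS _ x (fG i).1) // expr0n.
  (* If [b] were nonpositive at [x], all basis elements of degree at most [d] would vanish there,
     and the choice of [d] would place [x] in [S]. *)
  have bA x : (simplex_tilde R n `\` S) x -> 0 < b.@[x 0].
    case=> Sx nSx; rewrite ltNge; apply/negP => /sos_le0 fx0.
    apply: nSx; rewrite -dZ; split=> // g [gG gd].
    have gs : g \in s by rewrite mem_filter gd.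
    have lt_g : (index g s < size s)%N by rewrite index_mem.
    by have := fx0 (Ordinal lt_g); rewrite /f /= nth_index.
  have bsub : is_SUB P0 b.
    split=> [|x Sx|x]; last by rewrite altE; apply: bA.
      exists a, s0; split=> //; first exact: sS.
      by rewrite (bS s0) // gt_eqF // bA.
    by rewrite (bS x).
  split; last by move=> _ [c [csos csub] <-]; apply: sos_ge.
  exists b => //; apply/eqP; rewrite eqn_leq sos_ge // andbT.
  by apply: deg_sos_le => i; apply: (fG i).2.
Qed.
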